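(* As $n\to\infty$, $$\sup_{f\in H^n}\frac{|f|_{\mathcal{C}}}{|f|_{\mathcal{U}}}\in\Omega(2^n).$$
   Context: Let $\mathcal{B}=\{0,1\}$, let $\mathcal{B}^*$ be the set of finite binary strings and $|h|$ the length of $h\in\mathcal{B}^*$. For $n\in\mathbb{N}^+$, $H^n$ is the set of all functions $\mathcal{B}^n\to\mathcal{B}$. An interpreter is a Turing machine computing a partial function $\varphi:\mathcal{B}^*\times\mathcal{B}^*\to\mathcal{B}\cup\{\bot\}$, where $\bot$ denotes non-halting (or invalid) output. For $f\in H^n$, $|f|_\varphi=\min\{|h|:\varphi(h,x)=f(x)\ \forall x\in\mathcal{B}^n\}$ ($+\infty$ if no such $h$). Turing machines have alphabet $\{0,1,b\}$ ($b$ blank), a finite state set containing an initial state and two final states accept/reject; the output is $1$ if halting in accept, $0$ if halting in reject, $\bot$ otherwise; multi-tape machines have read-only input tapes and read/write work tapes, and the transition function is a finite list of rules. $E(T)$ is a fixed prefix-free binary encoding of a machine $T$ listing its rules. $\mathcal{U}$ is the universal interpreter: on $(p,x)$, if $p=E(T)u$ (concatenation) for a two-input-tape Turing machine $T$ (with a fixed number of work tapes) and $u\in\mathcal{B}^*$, it outputs $T(u,x)$; otherwise $\bot$. A Boolean circuit on $n$ inputs is a DAG with a unique sink (output) whose sources are labelled by input indices in $\{1,\dots,n\}$ and whose other vertices (gates) are labelled AND, OR (two incoming edges) or NOT (one incoming edge); its size $|C|$ is its number of vertices. The circuit interpreter $\mathcal{C}$ reads a program $h=0^{\lceil\log_2 n\rceil}1\,[\text{binary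 expansion of } n]\,0^{|C|}1\,[\text{description of vertex } i]_{i=1}^{|C|}$, each vertex being described by its label and its parents/input index using $\max\{2\lceil\log_2|C|\rceil,\lceil\log_2 n\rceil\}$ bits beyond the label bits, so a circuit $C$ on $n$ inputs has encoding length $L(|C|,n)=2\lceil\log_2 n\rceil+2+|C|(3+\max\{2\lceil\log_2|C|\rceil,\lceil\log_2 n\rceil\})$; $\mathcal{C}(h,x)$ is the circuit's output on $x\in\mathcal{B}^n$, and $\bot$ if $h$ is malformed. Hence $|f|_{\mathcal{C}}=\min\{L(|C|,n): C \text{ computes } f\}$. *)

(* Defs.v *)
From mathcomp Require Import all_boot all_order all_algebra.
From Stdlib Require Import ClassicalEpsilon.
Set Implicit Arguments. Unset Strict Implicit. Unset Printing Implicit Defensive.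

(* Minimum of a (possibly undecidable) predicate on nat; None = +oo   *)
Definition is_min_of (P : nat -> Prop) (m : nat) : Prop :=
  P m /\ forall m', P m' -> m <= m'.

Definition nat_min (P : nat -> Prop) : option nat :=
  match excluded_middle_informative (exists m, is_min_of P m) with
  | left H => Some (proj1_sig (constructive_indefinite_description _ H))
  | right _ => None
  end.

(* Turing machines: alphabet {0,1,b} = option bool (None = blank),    *)
(* two read-only input tapes (tape 0 holds u, tape 1 holds x) and     *)
(* k work tapes; tapes are two-way infinite, indexed by int.          *)
Definition sym := option bool.

Inductive dir := DL | DS | DR.

Definition dir_delta (d : dir) : int :=
  match d with DL => (-1)%R | DS => 0%R | DR => 1%R end.

Record rule (k : nat) := Rule {
  r_state  : nat;
  r_reads  : (2 + k).-tuple sym;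
  r_next   : nat;
  r_writes : k.-tuple sym;
  r_moves  : (2 + k).-tuple dir
}.

Record TM (k : nat) := MkTM { tm_rules : seq (rule k) }.

Definition st_init := 0.
Definition st_acc := 1.
Definition st_rej := 2.

Record config (k : nat) := Config {
  c_state : nat;
  c_head  : 'I_(2 + k) -> int;
  c_work  : 'I_k -> int -> sym
}.

Definition input_sym (s : seq bool) (p : int) : sym :=
  match p with
  | Posz m => if m < size s then Some (nth false s m) else None
  | Negz _ => None
  end.

Definition read_sym k (u x : seq bool) (c : config k) (i : 'I_(2 + k)) : sym :=
  match split i with
  | inl j => if val j == 0 then input_sym u (c_head c i)
             else input_sym x (c_head c i)
  | inr w => c_work c w (c_head c i)
  end.

Definition cur_reads k (u x : seq bool) (c : config k) : (2 + k).-tuple sym :=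
  [tuple read_sym u x c i | i < 2 + k].

Definition step k (T : TM k) (u x : seq bool) (c : config k) : option (config k) :=
  if (c_state c == st_acc) || (c_state c == st_rej) then None else
  match [seq r <- tm_rules T | (r_state r == c_state c)
                                && (r_reads r == cur_reads u x c)] with
  | [::] => None
  | r :: _ =>
      Some (Config (r_next r)
              (fun i => (c_head c i + dir_delta (tnth (r_moves r) i))%R)
              (fun w p => if p == c_head c (rshift 2 w)
                          then tnth (r_writes r) w else c_work c w p))
  end.

Definition init_config k : config k :=
  Config st_init (fun _ => 0%R) (fun _ _ => None).

Fixpoint exec k (T : TM k) (u x : seq bool) (t : nat) : option (config k) :=
  match t with
  | 0 => Some (init_config k)
  | t.+1 => match exec T u x t with
            | Some c => step T u x c
            | None => None
            end
  end.

Definition TM_out k (T : TM k) (u x : seq bool) (b : bool) : Prop :=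
  exists t c, exec T u x t = Some c /\
              c_state c = (if b then st_acc else st_rej).

Definition U_out k (E : TM k -> seq bool) (p x : seq bool) (b : bool) : Prop :=
  exists (T : TM k) (u : seq bool), p = E T ++ u /\ TM_out T u x b.

Definition Hfun (n : nat) := n.-tuple bool -> bool.

Definition size_U k (E : TM k -> seq bool) n (f : Hfun n) : option nat :=
  nat_min (fun m => exists h : seq bool,
             size h = m /\ forall x : n.-tuple bool, U_out E h x (f x)).

(* Boolean circuits, vertices listed in a topological order:          *)
(* parents of vertex i have indices < i.                              *)
Inductive gate (n : nat) :=
| GIn of 'I_n
| GNot of nat
| GAnd of nat & nat
| GOr of nat & nat.

Definition gate_parents n (g : gate n) : seq nat :=
  match g with
  | GIn _ => [::]
  | GNot j => [:: j]
  | GAnd a b => [:: a; b]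
  | GOr a b => [:: a; b]
  end.

Definition circuit (n : nat) := seq (gate n).

(* DAG (parents earlier) with a unique sink, namely the last vertex *)
Definition wf_circuit n (C : circuit n) : Prop :=
  0 < size C /\
  (forall i, i < size C -> all (fun j => j < i) (gate_parents (nth (GNot n 0) C i))) /\
  (forall i, i.+1 < size C ->
     exists j, i < j < size C /\ i \in gate_parents (nth (GNot n 0) C j)).

Definition gate_val n (x : n.-tuple bool) (vs : seq bool) (g : gate n) : bool :=
  match g with
  | GIn i => tnth x i
  | GNot j => ~~ nth false vs j
  | GAnd a b => nth false vs a && nth false vs b
  | GOr a b => nth false vs a || nth false vs b
  end.

Definition circ_vals n (C : circuit n) (x : n.-tuple bool) : seq bool :=
  foldl (fun vs g => rcons vs (gate_val x vs g)) [::] C.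

Definition circ_eval n (C : circuit n) (x : n.-tuple bool) : bool :=
  last false (circ_vals C x).

Definition clog2 (m : nat) : nat := up_log 2 m.

Definition enc_len (s n : nat) : nat :=
  2 * clog2 n + 2 + s * (3 + maxn (2 * clog2 s) (clog2 n)).

Definition size_C n (f : Hfun n) : option nat :=
  nat_min (fun m => exists C : circuit n,
             wf_circuit C /\ (forall x, circ_eval C x = f x) /\
             enc_len (size C) n = m).

(* Main.v *)
Require Import Defs.
From mathcomp Require Import all_boot all_order all_algebra.
From mathcomp Require Import zify.
From Stdlib Require Import ClassicalEpsilon FunctionalExtensionality.
Import Order.TTheory GRing.Theory Num.Theory.
Set Implicit Arguments. Unset Strict Implicit. Unset Printing Implicit Defensive.

(* A single Turing machine T computes, for all n at once, a function f_n of almost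
   maximal circuit complexity, so that |f_n|_U is bounded by the constant |E(T)| + 1.
   Circuits with at most s = (2^n - 1) / (3n) vertices are described by 3s digits in base
   2^n, hence by fewer than 2^(2^n) numbers, and f_n is the first truth table that no
   description produces. Any circuit for f_n thus has more than s vertices, and each of
   them costs at least 2 log s >= n bits, which gives |f_n|_C >= 2^n / 3.

   Time being irrelevant, f_n is written as a primitive recursive expression, compiled
   to a language of counters and loops, and this to a machine that keeps all counters in
   unary on interleaved tracks of one work tape. *)

(** * Primitive recursive expressions *)

(** Counting alone yields a hard function for each n separately; a program of bounded length needs a
    family that one machine finds uniformly in n, hence the effective search. As [TM] is a bare list
    of rules, this machine must be exhibited, and the intermediate languages keep each translation
    small. The input u = [[:: true]] marks the origin: tapes are infinite in both directions and
    show no edge, while code working on counters must find its way back to cell 0. The rate is 2^n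
    rather than 2^n / n because pointers cost bits on both sides: a description spends 3n bits on a
    gate, the circuit interpreter at least n, so only a factor 3 is lost. Finally, some circuit for
    f_n must be shown to exist, since |f_n|_C has to be an actual number. *)

Inductive expr :=
| EVar of nat
| EZero
| ESucc of expr
| ELet of expr & expr
| ELast of nat & expr
| ERec of expr & expr & expr.

(* Bound variables are appended to the environment (de Bruijn levels). [ELast m]
   keeps only the last m of them, which makes calls possible. Besides the index and the
   accumulator, the body of [ERec] sees the number of remaining rounds, which is
   the loop counter of the compiled code. *)
Fixpoint ev (env : seq nat) (e : expr) : nat :=
  match e with
  | EVar i => nth 0 env i
  | EZero => 0
  | ESucc e => (ev env e).+1
  | ELet e1 e2 => ev (env ++ [:: ev env e1]) e2
  | ELast m e => ev (drop (size env - m) env) e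
  | ERec n z b =>
      let N := ev env n in
      iteri N (fun i acc => ev (env ++ [:: N - i.+1; i; acc]) b)
            (ev (env ++ [:: N; 0]) z)
  end.

(** Variables are numbered from the outermost binding, so later arguments keep their indices
    although the earlier ones are already in the environment. *)
Definition call1 f a := ELet a (ELast 1 f).
Definition call2 f a b := ELet a (ELet b (ELast 2 f)).
Definition call3 f a b c := ELet a (ELet b (ELet c (ELast 3 f))).
Definition call4 f a b c d := ELet a (ELet b (ELet c (ELet d (ELast 4 f)))).

Lemma ev_rec env n z b N z0 f :
  ev env n = N -> ev (env ++ [:: N; 0]) z = z0 ->
  (forall r i acc, ev (env ++ [:: r; i; acc]) b = f i acc) ->
  ev env (ERec n z b) = iteri N f z0.
Proof. by move=> /= -> -> Hb; apply: eq_iteri => i acc; rewrite Hb. Qed.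

(** * Arithmetic, circuit simulation and the search as expressions *)

Local Notation V := EVar.

(** The opaque proof seals the expression: simplification unfolds the calls around it and stops at
    [ev [:: a; b] add_e], ready for [ev_add]. In the body of a recursion over an environment of
    length m, variables m, m+1, m+2 are the remaining rounds, the index and the accumulator. *)
Lemma add_expr : {e | forall a b, ev [:: a; b] e = a + b}.
Proof.
exists (ERec (V 0) (V 1) (ESucc (V 4))) => a b.
by rewrite (@ev_rec _ _ _ _ a b (fun _ acc => acc.+1)) //=; elim: a => //= a ->.
Qed.
Definition add_e := sval add_expr.
Definition ev_add a b : ev [:: a; b] add_e = a + b := svalP add_expr a b.

Lemma mul_expr : {e | forall a b, ev [:: a; b] e = a * b}.
Proof.
exists (ERec (V 0) EZero (call2 add_e (V 1) (V 4))) => a b.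
rewrite (@ev_rec _ _ _ _ a 0 (fun _ acc => b + acc)) //=; last first.
  by move=> r i acc /=; rewrite ev_add.
by elim: a => //= a ->; rewrite mulSn.
Qed.
Definition mul_e := sval mul_expr.
Definition ev_mul a b : ev [:: a; b] mul_e = a * b := svalP mul_expr a b.

Lemma pow2_expr : {e | forall a, ev [:: a] e = 2 ^ a}.
Proof.
exists (ERec (V 0) (ESucc EZero) (call2 add_e (V 3) (V 3))) => a.
rewrite (@ev_rec _ _ _ _ a 1 (fun _ acc => acc + acc)) //=; last first.
  by move=> r i acc /=; rewrite ev_add.
by elim: a => //= a ->; rewrite expnS mul2n addnn.
Qed.
Definition pow2_e := sval pow2_expr.
Definition ev_pow2 a : ev [:: a] pow2_e = 2 ^ a := svalP pow2_expr a.

Lemma pred_expr : {e | forall a, ev [:: a] e = a.-1}.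
Proof.
(* Each round returns its index, so the last one leaves [a.-1]. *)
exists (ERec (V 0) EZero (V 2)) => a.
by rewrite (@ev_rec _ _ _ _ a 0 (fun i _ => i)) //; case: a.
Qed.
Definition pred_e := sval pred_expr.
Definition ev_pred a : ev [:: a] pred_e = a.-1 := svalP pred_expr a.

Lemma sub_expr : {e | forall a b, ev [:: a; b] e = a - b}.
Proof.
exists (ERec (V 1) (V 0) (call1 pred_e (V 4))) => a b.
rewrite (@ev_rec _ _ _ _ b a (fun _ acc => acc.-1)) //=; last first.
  by move=> r i acc /=; rewrite ev_pred.
by elim: b => [|b /= ->]; rewrite ?subn0 ?subnS.
Qed.
Definition sub_e := sval sub_expr.
Definition ev_sub a b : ev [:: a; b] sub_e = a - b := svalP sub_expr a b.

Lemma isz_expr : {e | forall a, ev [:: a] e = (a == 0)}.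
Proof.
exists (ERec (V 0) (ESucc EZero) EZero) => a.
by rewrite (@ev_rec _ _ _ _ a 1 (fun _ _ => 0)) //; case: a.
Qed.
Definition isz_e := sval isz_expr.
Definition ev_isz a : ev [:: a] isz_e = (a == 0) := svalP isz_expr a.

(** Division counts the positive multiples of [d] up to [m]; since [m %/ d <= m], [m] rounds
    suffice. *)
Lemma div_count m d : 0 < d ->
  forall j, iteri j (fun i acc => acc + (i.+1 * d - m == 0)) 0 = minn j (m %/ d).
Proof.
move=> d0; elim=> [|j /= ->]; first by rewrite min0n.
rewrite subn_eq0 -leq_divRL //; lia.
Qed.

Lemma div_expr : {e | forall m d, 0 < d -> ev [:: m; d] e = m %/ d}.
Proof.
exists (ERec (V 0) EZero (call2 add_e (V 4)
         (call1 isz_e (call2 sub_e (call2 mul_e (ESucc (V 3)) (V 1)) (V 0))))) => m d d0.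
rewrite (@ev_rec _ _ _ _ m 0 (fun i acc => acc + (i.+1 * d - m == 0))) //=; last first.
  by move=> r i acc; rewrite /= ev_add ev_isz ev_sub ev_mul.
by rewrite div_count // (minn_idPr _) ?leq_div.
Qed.
Definition div_e := sval div_expr.
Definition ev_div m d : 0 < d -> ev [:: m; d] div_e = m %/ d := svalP div_expr m d.

Lemma mod_expr : {e | forall m d, 0 < d -> ev [:: m; d] e = m %% d}.
Proof.
exists (call2 sub_e (V 0) (call2 mul_e (call2 div_e (V 0) (V 1)) (V 1))) => m d d0.
by rewrite /= ev_sub ev_mul ev_div // {1}(divn_eq m d) addKn.
Qed.
Definition mod_e := sval mod_expr.
Definition ev_mod m d : 0 < d -> ev [:: m; d] mod_e = m %% d := svalP mod_expr m d.

Lemma odd_expr : {e | forall a, ev [:: a] e = odd a}.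
Proof.
exists (ERec (V 0) EZero (call1 isz_e (V 3))) => a.
rewrite (@ev_rec _ _ _ _ a 0 (fun _ acc => (acc == 0 : nat))) //=; last first.
  by move=> r i acc /=; rewrite ev_isz.
by elim: a => //= a ->; case: (odd a).
Qed.
Definition odd_e := sval odd_expr.
Definition ev_odd a : ev [:: a] odd_e = odd a := svalP odd_expr a.

Definition bit (v a : nat) : bool := odd (v %/ 2 ^ a).

Lemma bit_expr : {e | forall v a, ev [:: v; a] e = bit v a}.
Proof.
exists (call1 odd_e (call2 div_e (V 0) (call1 pow2_e (V 1)))) => v a.
by rewrite /= ev_odd ev_pow2 ev_div ?expn_gt0.
Qed.
Definition bit_e := sval bit_expr.
Definition ev_bit v a : ev [:: v; a] bit_e = bit v a := svalP bit_expr v a.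

Definition digit (n h i : nat) : nat := (h %/ 2 ^ (n * i)) %% 2 ^ n.

Lemma digit_expr : {e | forall n h i, ev [:: n; h; i] e = digit n h i}.
Proof.
exists (call2 mod_e (call2 div_e (V 1) (call1 pow2_e (call2 mul_e (V 0) (V 2))))
                   (call1 pow2_e (V 0))) => n h i.
by rewrite /= ev_mul !ev_pow2 !(ev_div, ev_mod) ?expn_gt0.
Qed.
Definition digit_e := sval digit_expr.
Definition ev_digit n h i : ev [:: n; h; i] digit_e = digit n h i := svalP digit_expr n h i.

(* The exclusive or with the first operand makes t = 0 a copy gate. *)
Definition gate_fun (t va vb : nat) : bool := odd (va + bit t (va + va + vb)).

Lemma gate_expr : {e | forall t a b, ev [:: t; a; b] e = gate_fun t a b}.
Proof.
exists (call1 odd_e (call2 add_e (V 1)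
         (call2 bit_e (V 0) (call2 add_e (call2 add_e (V 1) (V 1)) (V 2))))) => t a b.
by rewrite /= ev_odd !ev_add ev_bit.
Qed.
Definition gate_e := sval gate_expr.
Definition ev_gate t a b : ev [:: t; a; b] gate_e = gate_fun t a b := svalP gate_expr t a b.

(* v holds the values of all wires, the latest in bit 0; gate i of the description h
   is given by its three digits in base 2^n from 3i on. *)
Definition sim_step (n h i v : nat) : nat :=
  v + v + gate_fun (digit n h (i * 3)) (bit v (digit n h (i * 3).+1))
                   (bit v (digit n h (i * 3).+2)).

Lemma step_expr : {e | forall n h i v, ev [:: n; h; i; v] e = sim_step n h i v}.
Proof.
pose i3 := call2 mul_e (V 2) (ESucc (ESucc (ESucc EZero))).
exists (call2 add_e (call2 add_e (V 3) (V 3))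
  (call3 gate_e (call3 digit_e (V 0) (V 1) i3)
    (call2 bit_e (V 3) (call3 digit_e (V 0) (V 1) (ESucc i3)))
    (call2 bit_e (V 3) (call3 digit_e (V 0) (V 1) (ESucc (ESucc i3)))))) => n h i v.
by rewrite /= !ev_mul !ev_digit !ev_bit ev_gate !ev_add.
Qed.
Definition step_e := sval step_expr.
Definition ev_step n h i v : ev [:: n; h; i; v] step_e = sim_step n h i v :=
  svalP step_expr n h i v.

Definition sim (n h s X : nat) : nat := iteri s (sim_step n h) X.

Lemma sim_expr : {e | forall n h s X, ev [:: n; h; s; X] e = sim n h s X}.
Proof.
exists (ERec (V 2) (V 3) (call4 step_e (V 0) (V 1) (V 5) (V 6))) => n h s X.
rewrite (@ev_rec _ _ _ _ s X (sim_step n h)) // => r i acc.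
by rewrite /= ev_step.
Qed.
Definition sim_e := sval sim_expr.
Definition ev_sim n h s X : ev [:: n; h; s; X] sim_e = sim n h s X := svalP sim_expr n h s X.

(** Bounded quantifiers become arithmetic: this sum vanishes when the description agrees with the
    table on every input, and the product [mismatch_prod] when some description does. The parity
    compares the latest wire of [sim] with a bit of the table. *)
Definition mismatches (n h s g : nat) : nat :=
  iteri (2 ^ n) (fun X acc => acc + odd (sim n h s X + bit g X)) 0.

Lemma mismatches_expr :
  {e | forall n h s g, ev [:: n; h; s; g] e = mismatches n h s g}.
Proof.
exists (ERec (call1 pow2_e (V 0)) EZero (call2 add_e (V 6) (call1 odd_e
   (call2 add_e (call4 sim_e (V 0) (V 1) (V 2) (V 5)) (call2 bit_e (V 3) (V 5)))))) => n h s g.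
rewrite (@ev_rec _ _ _ _ (2 ^ n) 0 (fun X acc => acc + odd (sim n h s X + bit g X))) //.
  by rewrite /= ev_pow2.
move=> r i acc.
by rewrite /= ev_bit ev_sim !ev_add ev_odd.
Qed.
Definition mismatches_e := sval mismatches_expr.
Definition ev_mismatches n h s g : ev [:: n; h; s; g] mismatches_e = mismatches n h s g :=
  svalP mismatches_expr n h s g.

Definition ndesc (n s : nat) : nat := 2 ^ (n * (s * 3)).

Lemma ndesc_expr : {e | forall n s, ev [:: n; s] e = ndesc n s}.
Proof.
exists (call1 pow2_e (call2 mul_e (V 0) (call2 mul_e (V 1) (ESucc (ESucc (ESucc EZero)))))) => n s.
by rewrite /= ev_pow2 !ev_mul.
Qed.
Definition ndesc_e := sval ndesc_expr.
Definition ev_ndesc n s : ev [:: n; s] ndesc_e = ndesc n s := svalP ndesc_expr n s.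

Definition mismatch_prod (n s g : nat) : nat :=
  iteri (ndesc n s) (fun h acc => acc * mismatches n h s g) 1.

Lemma mismatch_prod_expr :
  {e | forall n s g, ev [:: n; s; g] e = mismatch_prod n s g}.
Proof.
exists (ERec (call2 ndesc_e (V 0) (V 1)) (ESucc EZero)
   (call2 mul_e (V 5) (call4 mismatches_e (V 0) (V 4) (V 1) (V 2)))) => n s g.
rewrite (@ev_rec _ _ _ _ (ndesc n s) 1 (fun h acc => acc * mismatches n h s g)) //.
  by rewrite /= ev_ndesc.
by move=> r i acc; rewrite /= ev_mismatches ev_mul.
Qed.
Definition mismatch_prod_e := sval mismatch_prod_expr.
Definition ev_mismatch_prod n s g : ev [:: n; s; g] mismatch_prod_e = mismatch_prod n s g :=
  svalP mismatch_prod_expr n s g.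

(* Numbers below 2^(2^n) encode truth tables. Every table met by a description is
   skipped; after as many rounds as there are descriptions, the iteration has stabilised. *)
Definition hard_table (n s : nat) : nat :=
  iteri (ndesc n s) (fun _ g => g + (mismatch_prod n s g == 0)) 0.

Lemma hard_table_expr : {e | forall n s, ev [:: n; s] e = hard_table n s}.
Proof.
exists (ERec (call2 ndesc_e (V 0) (V 1)) EZero (call2 add_e (V 4)
   (call1 isz_e (call3 mismatch_prod_e (V 0) (V 1) (V 4))))) => n s.
rewrite (@ev_rec _ _ _ _ (ndesc n s) 0 (fun _ g => g + (mismatch_prod n s g == 0))) //.
  by rewrite /= ev_ndesc.
by move=> r i acc; rewrite /= ev_mismatch_prod ev_isz ev_add.
Qed.
Definition hard_table_e := sval hard_table_expr.
Definition ev_hard_table n s : ev [:: n; s] hard_table_e = hard_table n s :=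
  svalP hard_table_expr n s.

(** For positive n, the largest s with 3ns < 2^n, that is, with fewer descriptions than truth
    tables. *)
Definition hard_size (n : nat) : nat := (2 ^ n - 1) %/ (n * 3).
Definition hard_bit (n X : nat) : bool := bit (hard_table n (hard_size n)) X.

Lemma hard_expr : {e | forall n X, 0 < n -> ev [:: n; X] e = hard_bit n X}.
Proof.
exists (call2 bit_e (call2 hard_table_e (V 0) (call2 div_e
   (call2 sub_e (call1 pow2_e (V 0)) (ESucc EZero))
   (call2 mul_e (V 0) (ESucc (ESucc (ESucc EZero)))))) (V 1)) => n X n0.
by rewrite /= ev_pow2 ev_sub ev_mul ev_div ?muln_gt0 ?n0 // ev_hard_table ev_bit.
Qed.

(** * Diagonalisation against circuits *)

Lemma bit_double0 v (b : bool) : bit (v + v + b) 0 = b.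
Proof. by rewrite /bit expn0 divn1 oddD oddD addbb oddb. Qed.

Lemma bit_doubleS v (b : bool) r : bit (v + v + b) r.+1 = bit v r.
Proof. by rewrite /bit expnS divnMA addnn divn2 addnC half_bit_double. Qed.

Lemma bitS v r : bit v r.+1 = bit v./2 r.
Proof. by rewrite /bit expnS divnMA divn2. Qed.

Lemma bit0 v : bit v 0 = odd v.
Proof. by rewrite /bit expn0 divn1. Qed.

Lemma bit_inj m x y : x < 2 ^ m -> y < 2 ^ m ->
  (forall i, i < m -> bit x i = bit y i) -> x = y.
Proof.
elim: m x y => [|m IHm] x y; first by rewrite expn0 !ltnS !leqn0 => /eqP-> /eqP->.
rewrite expnS => xm ym E; rewrite -(odd_double_half x) -(odd_double_half y).
rewrite (IHm x./2 y./2); try lia; last by move=> i im; rewrite -!bitS E.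
by rewrite -!bit0 E.
Qed.

Definition num (n : nat) (l : seq nat) : nat := foldr (fun d acc => d + 2 ^ n * acc) 0 l.

Lemma num_lt n l : all (fun d => d < 2 ^ n) l -> num n l < 2 ^ (n * size l).
Proof.
elim: l => [|d l IHl] /=; first by rewrite muln0.
case/andP=> dn /IHl {}IHl; rewrite mulnS expnD.
apply: (@leq_trans (2 ^ n * (num n l).+1)); last by rewrite leq_mul2l IHl orbT.
by rewrite mulnS; lia.
Qed.

Lemma digit_num n l i : all (fun d => d < 2 ^ n) l -> digit n (num n l) i = nth 0 l i.
Proof.
rewrite /digit; elim: l i => [|d l IHl] i /=; first by rewrite div0n mod0n nth_nil.
have P : 0 < 2 ^ n by rewrite expn_gt0.
case/andP=> dn /IHl {}IHl; case: i => [|i] /=.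
  by rewrite muln0 expn0 divn1 mulnC addnC modnMDl modn_small.
by rewrite mulnS expnD divnMA mulnC addnC divnMDl // (divn_small dn) addn0 IHl.
Qed.

Lemma mismatches_eq0 n h s g :
  reflect (forall X, X < 2 ^ n -> odd (sim n h s X) = bit g X) (mismatches n h s g == 0).
Proof.
apply: (iffP idP); rewrite /mismatches; move: (2 ^ n) => m.
  elim: m => // m IHm /=; rewrite addn_eq0 eqb0 oddD oddb => /andP[/IHm {}IHm /negPf E] X.
  rewrite ltnS leq_eqVlt => /orP[/eqP->|/IHm//].
  by move: E; case: odd; case: bit.
elim: m => //= m IHm E; rewrite addn_eq0 IHm => [|X Xm]; last by apply: E; apply: ltnW.
by rewrite oddD oddb E // addbb.
Qed.

Lemma mismatch_prod_eq0 n s g :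
  (mismatch_prod n s g == 0) = [exists h : 'I_(ndesc n s), mismatches n h s g == 0].
Proof.
rewrite /mismatch_prod; move: (ndesc n s) => m.
apply/idP/existsP => [|[h]].
  elim: m => // m IHm /=; rewrite muln_eq0 => /orP[/IHm[h Eh]|E].
    by exists (widen_ord (leqnSn m) h); exact: Eh.
  by exists ord_max.
case: h => h /=; elim: m => // m IHm; rewrite ltnS leq_eqVlt /= => /orP[/eqP->|/IHm hm /hm/eqP->].
  by move/eqP->; rewrite muln0.
by rewrite mul0n.
Qed.

(** An iterate with nonzero product is a fixed point. So if the last iterate were still described,
    all earlier ones would be too, and the iteration would have passed through 0, 1, ..., K.
    Choosing a description for each of these K + 1 tables is injective, because a description
    determines all 2^n bits of its table; but there are only K descriptions. *)
Lemma hard_table_mismatch n s h : ndesc n s < 2 ^ (2 ^ n) -> h < ndesc n s ->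
  mismatches n h s (hard_table n s) != 0.
Proof.
move=> small hK; set K := ndesc n s in small hK.
pose T j := iteri j (fun _ g => g + (mismatch_prod n s g == 0)) 0.
have TS j : T j.+1 = T j + (mismatch_prod n s (T j) == 0) by [].
apply/negP => E.
have TK : mismatch_prod n s (T K) == 0.
  by rewrite mismatch_prod_eq0; apply/existsP; exists (Ordinal hK).
have all0 j : j <= K -> mismatch_prod n s (T j) == 0.
  move=> jK; apply/idPn => Nj; move: TK; suff -> : T K = T j by rewrite (negPf Nj).
  rewrite -(subnKC jK); elim: (K - j) => [|d IHd]; first by rewrite addn0.
  by rewrite addnS TS IHd (negPf Nj) addn0.
have Tid j : j <= K -> T j = j.
  elim: j => // j IHj jK; rewrite TS all0 ?IHj 1?ltnW // addn1 //.
have ex (g : 'I_K.+1) : exists h : 'I_K, mismatches n h s g == 0.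
  have gK : g <= K by rewrite -ltnS.
  by apply/existsP; rewrite -mismatch_prod_eq0 -(Tid g gK) all0.
have ltT (g : 'I_K.+1) : g < 2 ^ (2 ^ n) by apply: leq_ltn_trans small; rewrite -ltnS.
pose F g := xchoose (ex g).
have /leq_card : injective F.
  move=> g g' EF; apply/val_inj/(@bit_inj (2 ^ n)).
  - exact: ltT.
  - exact: ltT.
  move=> X Xn; have /mismatches_eq0 <- // := xchooseP (ex g).
  by have /mismatches_eq0 <- // := xchooseP (ex g'); rewrite -/(F g) EF.
by rewrite !card_ord ltnn.
Qed.

(** * Circuits as numbers *)

Definition bval (s : seq bool) : nat := foldl (fun a (b : bool) => a + a + b) 0 s.

Lemma bval_rcons s b : bval (rcons s b) = bval s + bval s + b.
Proof. by rewrite /bval foldl_rcons. Qed.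

(** Horner's rule puts the first symbol in the highest place, so a machine can evaluate it while
    reading; hence the reversal here and [n.-1 - j] in [gate_code]. *)
Lemma bit_bval s i : bit (bval s) i = nth false (rev s) i.
Proof.
elim/last_ind: s i => [|s b IHs] i; first by rewrite /bit div0n nth_nil.
by rewrite bval_rcons rev_rcons; case: i => [|i]; rewrite ?bit_double0 ?bit_doubleS.
Qed.

Lemma bval_lt s : bval s < 2 ^ size s.
Proof.
elim/last_ind: s => // s b IHs; rewrite bval_rcons size_rcons expnS.
by move: IHs; case: b; lia.
Qed.

Lemma bval_onto n X : X < 2 ^ n -> exists x : n.-tuple bool, bval x = X.
Proof.
move=> Xn; have sz : size (rev (mkseq (bit X) n)) == n by rewrite size_rev size_mkseq.
exists (Tuple sz); apply: (@bit_inj n) => //.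
  by have := bval_lt (rev (mkseq (bit X) n)); rewrite (eqP sz).
by move=> i im; rewrite bit_bval revK nth_mkseq.
Qed.

(* Wires are numbered backwards from the gate being described: wire 0 is the
   previous gate, and the inputs come after all gates. The code (0, 0, 0) thus copies the
   previous value, so that zero digits pad a description. The operation code t is
   a truth table, shifted by the first wire, as in [gate_fun]. *)
Definition gate_code n (i : nat) (g : gate n) : seq nat :=
  match g with
  | GIn j => [:: 0; i + (n.-1 - j); 0]
  | GNot j => [:: 9; i.-1 - j; i.-1 - j]
  | GAnd a b => [:: 4; i.-1 - a; i.-1 - b]
  | GOr a b => [:: 2; i.-1 - a; i.-1 - b]
  end.

Definition circuit_digits n (C : circuit n) : seq nat :=
  mkseq (fun m => nth 0 (gate_code (m %/ 3) (nth (GNot n 0) C (m %/ 3))) (m %% 3))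
        (size C * 3).

Lemma nth_circuit_digits n (C : circuit n) i r : i < size C -> r < 3 ->
  nth 0 (circuit_digits C) (i * 3 + r) = nth 0 (gate_code i (nth (GNot n 0) C i)) r.
Proof.
move=> iC r3; rewrite nth_mkseq; last by lia.
by rewrite divnMDl // modnMDl divn_small // modn_small // addn0.
Qed.

Lemma nth_circuit_digits_default n (C : circuit n) m : size C * 3 <= m ->
  nth 0 (circuit_digits C) m = 0.
Proof. by move=> Cm; rewrite nth_default // size_mkseq. Qed.

(** Operation codes are at most 9, whence [3 < n]; wire numbers stay below [size C + n]. *)
Lemma circuit_digits_lt n (C : circuit n) : 3 < n -> size C + n < 2 ^ n ->
  all (fun d => d < 2 ^ n) (circuit_digits C).
Proof.
move=> n3 Cn; have n16 : 15 < 2 ^ n by rewrite (@leq_exp2l 2 4).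
apply/(all_nthP 0) => m; rewrite size_mkseq => mC; rewrite nth_mkseq //.
have : m %/ 3 < size C by rewrite ltn_divLR.
have : m %% 3 < 3 by rewrite ltn_mod.
move: (m %/ 3) (m %% 3) => i r r3 iC.
by case: (nth (GNot n 0) C i) => [j|j|a b|a b]; case: r r3 => [|[|[|//]]] _ /=; lia.
Qed.

Lemma circ_vals_rcons n (C : circuit n) x g :
  circ_vals (rcons C g) x = rcons (circ_vals C x) (gate_val x (circ_vals C x) g).
Proof. by rewrite /circ_vals foldl_rcons. Qed.

Lemma size_circ_vals n (C : circuit n) x : size (circ_vals C x) = size C.
Proof.
elim/last_ind: C => // C g IHC.
by rewrite circ_vals_rcons !size_rcons IHC.
Qed.

Section Simulation.

Variables (n : nat) (C : circuit n) (x : n.-tuple bool).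
Hypotheses (n3 : 3 < n) (Cn : size C + n < 2 ^ n).
Hypothesis ordered :
  forall i, i < size C -> all (fun j => j < i) (gate_parents (nth (GNot n 0) C i)).

Let h := num n (circuit_digits C).
Let v i := iteri i (sim_step n h) (bval x).
Let vs i := circ_vals (take i C) x.

Let gate_digit i r : i < size C -> r < 3 ->
  digit n h (i * 3 + r) = nth 0 (gate_code i (nth (GNot n 0) C i)) r.
Proof. by move=> iC r3; rewrite digit_num ?circuit_digits_lt // nth_circuit_digits. Qed.

(** The state is a stack: doubling pushes the new value into bit 0 and moves every older wire up by
    one, with the reversed input at the bottom. *)
Lemma sim_circuit i : i <= size C ->
  forall r, bit (v i) r = nth false (rev (vs i) ++ rev x) r.
Proof.
elim: i => [|i IHi] iC r; first by rewrite /v /vs take0 /= bit_bval.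
have {}IHi := IHi (ltnW iC).
have szv : size (vs i) = i by rewrite size_circ_vals size_take iC.
have wire j : j < i -> bit (v i) (i.-1 - j) = nth false (vs i) j.
  move=> ji; rewrite IHi nth_cat size_rev szv.
  have ij : i.-1 - j < i by lia.
  by rewrite ij nth_rev szv //; congr nth; lia.
have input (j : 'I_n) : bit (v i) (i + (n.-1 - j)) = tnth x j.
  have jn := ltn_ord j.
  rewrite IHi nth_cat size_rev szv ltnNge leq_addr /= addKn nth_rev size_tuple; last by lia.
  by rewrite (tnth_nth false); congr nth; lia.
have -> : vs i.+1 = rcons (vs i) (gate_val x (vs i) (nth (GNot n 0) C i)).
  by rewrite /vs (take_nth (GNot n 0)) // circ_vals_rcons.
rewrite rev_rcons cat_cons.
suff -> : v i.+1 = v i + v i + gate_val x (vs i) (nth (GNot n 0) C i).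
  by case: r => [|r]; rewrite ?bit_double0 ?bit_doubleS.
rewrite /v /= -/(v i) /sim_step; congr (_ + nat_of_bool _).
rewrite -[i * 3]addn0 -!addnS !gate_digit //.
have := ordered iC; case: (nth (GNot n 0) C i) => [j|j|a b|a b] /=.
- by rewrite input; move: (tnth x j) (bit _ _) => [] [].
- by rewrite andbT => ji; rewrite wire //; case: (nth false _ j).
- by case/and3P=> ai bi _; rewrite !wire //; move: (nth _ _ a) (nth _ _ b) => [] [].
- by case/and3P=> ai bi _; rewrite !wire //; move: (nth _ _ a) (nth _ _ b) => [] [].
Qed.

Lemma sim_circuit_padded s : 0 < size C -> size C <= s ->
  odd (sim n h s (bval x)) = circ_eval C x.
Proof.
move=> C0 /subnKC <-; elim: (s - size C) => [|d IHd].
  rewrite addn0 -bit0 sim_circuit // /vs take_size nth_cat size_rev size_circ_vals C0.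
  by rewrite nth_rev size_circ_vals // subn1 -(size_circ_vals C x) nth_last.
rewrite addnS -IHd /sim /= -bit0 bit_double0.
rewrite !digit_num ?circuit_digits_lt // !nth_circuit_digits_default; try lia.
by rewrite bit0; case: odd.
Qed.

Lemma description_lt s : size C <= s -> h < ndesc n s.
Proof.
move=> Cs; apply: leq_trans (num_lt (circuit_digits_lt n3 Cn)) _.
by rewrite size_mkseq leq_exp2l // leq_mul // leq_mul.
Qed.

End Simulation.

(** Origin of the threshold 10: 30^2 = 900 <= 1024, whereas 27^2 = 729 > 512. *)
Lemma sqr_3n_le n : 10 <= n -> (n * 3) ^ 2 <= 2 ^ n.
Proof.
elim: n => // n IHn; rewrite leq_eqVlt => /orP[/eqP<-//|n10].
have {}IHn := IHn n10; rewrite expnS.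
by move: IHn; rewrite !expnS !expn0 !muln1; nia.
Qed.

Lemma hard_size_lt n : 10 <= n ->
  hard_size n + n < 2 ^ n /\ ndesc n (hard_size n) < 2 ^ (2 ^ n).
Proof.
move=> n10; have := sqr_3n_le n10; rewrite /ndesc ltn_exp2l // /hard_size.
have := leq_divM (2 ^ n - 1) (n * 3); have : 0 < 2 ^ n by rewrite expn_gt0.
by rewrite !expnS expn0 muln1; nia.
Qed.

Definition hard_fun n : Hfun n := fun x => hard_bit n (bval x).

Lemma hard_fun_size n (C : circuit n) : 10 <= n -> wf_circuit C ->
  (forall x, circ_eval C x = hard_fun x) -> hard_size n < size C.
Proof.
move=> n10 [C0 [ordered _]] Cf; have [sn small] := hard_size_lt n10.
rewrite ltnNge; apply/negP => Cs.
have Cn : size C + n < 2 ^ n by apply: leq_ltn_trans sn; rewrite leq_add2r.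
have n3 : 3 < n by apply: leq_trans n10.
have /negP[] := hard_table_mismatch small (description_lt n3 Cn Cs).
apply/mismatches_eq0 => X /bval_onto[x <-].
by rewrite sim_circuit_padded // Cf.
Qed.

(** * Existence of circuits *)

Section Fragments.

Variable n : nat.
Implicit Types (c : circuit n) (f g : Hfun n) (x : n.-tuple bool).

(* A circuit fragment whose vertices are numbered from o on. *)
Definition fragment (o : nat) c :=
  [/\ 0 < size c,
      forall i, i < size c -> all (fun j => j < o + i) (gate_parents (nth (GNot n 0) c i)) &
      forall i, i.+1 < size c ->
        exists2 j, i < j < size c & o + i \in gate_parents (nth (GNot n 0) c j)].

Definition vals_from (vs : seq bool) c x : seq bool :=
  foldl (fun vs (g : gate n) => rcons vs (gate_val x vs g)) vs c.

(** Quantifying over the offset and over the values already present lets fragments be placed one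
    behind the other. Nothing is shared between them, so each keeps its single sink. *)
Definition has_circuit f := forall o, exists c, fragment o c /\
  forall vs x, size vs = o -> exists u,
    (size u).+1 = size c /\ vals_from vs c x = vs ++ rcons u (f x).

Lemma has_circuit_ext f g : f =1 g -> has_circuit f -> has_circuit g.
Proof.
move=> fg hf o; have [c [fc vc]] := hf o; exists c; split=> // vs x /vc-/(_ x).
by rewrite fg.
Qed.

Lemma has_circuit_input (i : 'I_n) : has_circuit (fun x => tnth x i).
Proof.
move=> o; exists [:: GIn i]; split; last by move=> vs x _; exists [::]; rewrite /vals_from /= cats1.
by split=> // -[].
Qed.

Lemma has_circuit_not f : has_circuit f -> has_circuit (fun x => ~~ f x).
Proof.
move=> hf o; have [c [[c0 ord sink] vc]] := hf o.
exists (rcons c (GNot n (o + (size c).-1))); split.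
  split=> [|i|i]; rewrite size_rcons // ltnS.
    rewrite leq_eqVlt nth_rcons => /orP[/eqP->|ic].
      by rewrite ltnn eqxx /= andbT ltn_add2l prednK.
    by rewrite ic ord.
  case: (ltnP i.+1 (size c)) => [/sink[j /andP[ij jc] ji] _|ci ic].
    by exists j; rewrite ?ij ?nth_rcons ?jc //= ltnW.
  exists (size c); rewrite ?ic ?leqnn // nth_rcons ltnn eqxx /= inE eqn_add2l.
  by apply/eqP; lia.
move=> vs x vso; have [u [su vu]] := vc vs x vso; exists (rcons u (f x)).
split; first by rewrite !size_rcons su.
rewrite /vals_from foldl_rcons -/(vals_from vs c x) vu /= rcons_cat.
congr (_ ++ rcons _ (~~ _)).
by rewrite -su nth_cat -vso ltnNge leq_addr /= addKn nth_rcons ltnn eqxx.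
Qed.

(** The gate added at the end is the child that the two former sinks lack. *)
Lemma has_circuit_binary (G : nat -> nat -> gate n) (op : bool -> bool -> bool) f g :
  (forall a b, gate_parents (G a b) = [:: a; b]) ->
  (forall x vs a b, gate_val x vs (G a b) = op (nth false vs a) (nth false vs b)) ->
  has_circuit f -> has_circuit g -> has_circuit (fun x => op (f x) (g x)).
Proof.
move=> Gp Gv hf hg o.
have [c [[c0 cord csink] vc]] := hf o.
have [d [[d0 dord dsink] vd]] := hg (o + size c).
pose a := o + (size c).-1; pose b := o + size c + (size d).-1.
exists (rcons (c ++ d) (G a b)); split.
  split=> [|i|i]; rewrite size_rcons // ltnS size_cat.
    rewrite nth_rcons size_cat leq_eqVlt => /orP[/eqP->|icd].
      by rewrite ltnn eqxx Gp /= andbT; apply/andP; rewrite /a /b; lia.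
    rewrite icd nth_cat; case: (ltnP i (size c)) => [/cord//|ci].
    have /dord : i - size c < size d by lia.
    by apply: sub_all => j; rewrite -addnA subnKC.
  move=> icd.
  have [/csink[j /andP[ij jc] ji]|ci] := ltnP i.+1 (size c).
    exists j; first by lia.
    by rewrite nth_rcons size_cat ltn_addr // nth_cat jc.
  have [ic|ic] := eqVneq i.+1 (size c).
    exists (size c + size d); first by lia.
    by rewrite nth_rcons size_cat ltnn eqxx Gp !inE /a -ic eqxx.
  have [id|di] := ltnP (i - size c).+1 (size d).
    have [j jd ji] := dsink _ id; exists (size c + j); first by lia.
    rewrite nth_rcons size_cat ltn_add2l (_ : j < size d); last by lia.
    rewrite nth_cat ltnNge leq_addr /= addKn.
    by rewrite (_ : o + i = o + size c + (i - size c)) //; lia.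
  exists (size c + size d); first by lia.
  by rewrite nth_rcons size_cat ltnn eqxx Gp !inE /b; apply/orP; right; apply/eqP; lia.
move=> vs x vso; have [u [su vu]] := vc vs x vso.
have [|w [sw vw]] := vd (vs ++ rcons u (f x)) x; first by rewrite size_cat size_rcons su vso.
exists (rcons u (f x) ++ rcons w (g x)).
split; first by rewrite size_rcons !size_cat !size_rcons su sw.
rewrite /vals_from foldl_rcons foldl_cat -/(vals_from vs c x) vu.
rewrite -/(vals_from _ d x) vw -catA rcons_cat Gv; congr (_ ++ rcons _ (op _ _)).
  rewrite /a -su -vso /= nth_cat ltnNge leq_addr /= addKn nth_cat size_rcons ltnSn.
  by rewrite nth_rcons ltnn eqxx.
rewrite /b -su -sw -vso /= -addnA nth_cat ltnNge leq_addr /= addKn nth_cat size_rcons.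
by rewrite ltnNge leq_addr /= addKn nth_rcons ltnn eqxx.
Qed.

Lemma has_circuit_and f g :
  has_circuit f -> has_circuit g -> has_circuit (fun x => f x && g x).
Proof. exact: (@has_circuit_binary (@GAnd n) andb). Qed.

Lemma has_circuit_or f g :
  has_circuit f -> has_circuit g -> has_circuit (fun x => f x || g x).
Proof. exact: (@has_circuit_binary (@GOr n) orb). Qed.

(** There are no constant gates; an input combined with its negation replaces them, which takes
    [0 < n]. *)
Lemma has_circuit_const (b : bool) : 0 < n -> has_circuit (fun=> b).
Proof.
move=> n0; have h := has_circuit_input (Ordinal n0).
case: b; [apply: has_circuit_ext (has_circuit_or h (has_circuit_not h))|
          apply: has_circuit_ext (has_circuit_and h (has_circuit_not h))] => x.
  exact: orbN.
exact: andbN.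
Qed.

(** Disjunctive normal form, one conjunction for each point of the cube. Its size does not matter,
    only that [size_C] is not [None]. *)
Lemma has_circuit_all f : 0 < n -> has_circuit f.
Proof.
move=> n0.
have eq_circuit (y : n.-tuple bool) : has_circuit (fun x => x == y).
  apply: (@has_circuit_ext (fun x => all (fun i => tnth x i == tnth y i) (enum 'I_n))).
    move=> x; apply/allP/eqP => [E|-> //]; apply: eq_from_tnth => i.
    by apply/eqP/E; rewrite mem_enum.
  elim: (enum 'I_n) => [|i s IHs] /=; first exact: has_circuit_const.
  apply: has_circuit_and IHs; have h := has_circuit_input i.
  case: (tnth y i); first by apply: has_circuit_ext h => x; case: (tnth x i).
  by apply: has_circuit_ext (has_circuit_not h) => x; case: (tnth x i).
apply: (@has_circuit_ext (fun x => has (fun y => (x == y) && f y) (enum {: n.-tuple bool}))).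
  move=> x; apply/hasP/idP => [[y _ /andP[/eqP->]] //|fx].
  by exists x; rewrite ?mem_enum ?eqxx.
elim: (enum _) => [|y s IHs] /=; first exact: has_circuit_const.
apply: has_circuit_or IHs; apply: has_circuit_and => //; exact: has_circuit_const.
Qed.

Lemma circuit_exists f : 0 < n -> exists C, wf_circuit C /\ forall x, circ_eval C x = f x.
Proof.
move=> n0; have [C [[C0 ord sink] vC]] := has_circuit_all f n0 0.
exists C; split.
  by split=> //; split=> // i /sink[j]; exists j.
move=> x; have [u [_ E]] := vC [::] x erefl.
by rewrite /circ_eval -[circ_vals C x]/(vals_from [::] C x) E last_rcons.
Qed.

End Fragments.

(** * From vertex counts to code lengths *)

Lemma nat_min_some (P : nat -> Prop) m : P m ->
  exists2 a, nat_min P = Some a & P a /\ a <= m.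
Proof.
move=> Pm; have [a [Pa mina]] : exists a, is_min_of P a.
  elim/ltn_ind: m Pm => m IHm Pm.
  case: (excluded_middle_informative (exists2 j, j < m & P j)) => [[j jm /(IHm j jm)]//|N].
  exists m; split=> // j Pj; rewrite leqNgt; apply/negP => jm; apply: N; by exists j.
rewrite /nat_min; case: excluded_middle_informative => [H|[]]; last by exists a.
case: constructive_indefinite_description => b /= [Pb minb].
by exists b => //; split=> //; apply: minb.
Qed.

(** Squaring 2^n <= 3nS and cancelling (3n)^2 <= 2^n leaves 2^n <= S^2, so [n <= 2 * clog2 S]: the
    bits per vertex make up for the factor n lost in the vertex count. *)
Lemma enc_len_hard n S : 10 <= n -> hard_size n < S -> 2 ^ n <= enc_len S n * 3.
Proof.
move=> n10 hS; have n3 := sqr_3n_le n10.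
have N0 : 0 < 2 ^ n by rewrite expn_gt0.
have S3n : 2 ^ n <= S * (n * 3).
  have : 2 ^ n - 1 < (hard_size n).+1 * (n * 3) by apply: ltn_ceil; lia.
  have : (hard_size n).+1 * (n * 3) <= S * (n * 3) by rewrite leq_mul2r hS orbT.
  by lia.
have SS : 2 ^ n <= S ^ 2.
  rewrite -(leq_pmul2r N0); apply: leq_trans (leq_mul S3n S3n) _.
  by rewrite mulnACA !mulnn leq_mul2l n3 orbT.
have nS : n <= clog2 S * 2.
  rewrite -(@leq_exp2l 2) // expnM; apply: leq_trans SS _.
  by rewrite leq_sqr up_logP.
apply: leq_trans S3n _; rewrite mulnA leq_mul2r /= /enc_len.
apply: leq_trans (leq_addl _ _); rewrite leq_mul2l; apply/orP; right.
by lia.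
Qed.

(** * Counter programs *)

(** [Loop r] decrements [r] before each round until it is 0, and is thus also the way to erase a
    counter. [Read c d] consumes the remaining input, running [c] on each 0 and [d] on each 1. *)
Inductive cmd :=
| Skip
| Inc of nat
| Seq of cmd & cmd
| Loop of nat & cmd
| Read of cmd & cmd.

Local Notation regs := (nat -> nat).

Definition upd (s : regs) (r v : nat) : regs := fun i => if i == r then v else s i.

Inductive bigstep : cmd -> regs -> seq bool -> regs -> seq bool -> Prop :=
| BSkip s x : bigstep Skip s x s x
| BInc r s x : bigstep (Inc r) s x (upd s r (s r).+1) x
| BSeq c d s1 x1 s2 x2 s3 x3 :
    bigstep c s1 x1 s2 x2 -> bigstep d s2 x2 s3 x3 -> bigstep (Seq c d) s1 x1 s3 x3
| BLoop0 r c s x : s r = 0 -> bigstep (Loop r c) s x s x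
| BLoopS r c s1 x1 s2 x2 s3 x3 m : s1 r = m.+1 ->
    bigstep c (upd s1 r m) x1 s2 x2 -> bigstep (Loop r c) s2 x2 s3 x3 ->
    bigstep (Loop r c) s1 x1 s3 x3
| BRead0 c d s : bigstep (Read c d) s [::] s [::]
| BReadS c d s1 (b : bool) x1 s2 x2 s3 x3 :
    bigstep (if b then d else c) s1 x1 s2 x2 -> bigstep (Read c d) s2 x2 s3 x3 ->
    bigstep (Read c d) s1 (b :: x1) s3 x3.

Definition st (l : seq nat) : regs := nth 0 l.

Definition runs c l l' := forall x, bigstep c (st l) x (st l') x.

Lemma runs_seq c d l1 l2 l3 : runs c l1 l2 -> runs d l2 l3 -> runs (Seq c d) l1 l3.
Proof. by move=> h1 h2 x; apply: BSeq (h1 x) (h2 x). Qed.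

(** Registers beyond the list hold 0, so scratch counters can be appended when needed and dropped
    once cleared. *)
Lemma st_cat0 l k : st (l ++ nseq k 0) = st l.
Proof.
apply: functional_extensionality => i; rewrite /st nth_cat nth_nseq.
by case: ltnP => // li; rewrite nth_default // if_same.
Qed.

Lemma runs_cat0l k c l l' : runs c (l ++ nseq k 0) l' -> runs c l l'.
Proof. by rewrite /runs st_cat0. Qed.

Lemma runs_cat0r k c l l' : runs c l (l' ++ nseq k 0) -> runs c l l'.
Proof. by rewrite /runs st_cat0. Qed.

Lemma upd_st L T j v : upd (st (L ++ T)) (size L + j) v = st (L ++ set_nth 0 T j v).
Proof.
apply: functional_extensionality => i; rewrite /upd /st !nth_cat nth_set_nth /=.
case: ltnP => Li; first by rewrite ltn_eqF // ltn_addr.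
by rewrite -{1}(subnKC Li) eqn_add2l.
Qed.

Lemma st_cat L T j : st (L ++ T) (size L + j) = nth 0 T j.
Proof. by rewrite /st nth_cat ltnNge leq_addr /= addKn. Qed.

Lemma runs_inc L T j :
  runs (Inc (size L + j)) (L ++ T) (L ++ set_nth 0 T j (nth 0 T j).+1).
Proof. by move=> x; rewrite -upd_st -(st_cat L); apply: BInc. Qed.

(** [F i] is the state before round [i], and [G i] the same state with the counter already
    decremented, which is what the body sees. *)
Lemma runs_loop_seq c r m (F G : nat -> seq nat) :
  (forall i, i <= m -> st (F i) r = m - i) ->
  (forall i, i < m -> st (G i) = upd (st (F i)) r (m - i.+1)) ->
  (forall i, i < m -> runs c (G i) (F i.+1)) ->
  runs (Loop r c) (F 0) (F m).
Proof.
move=> Fr GF body x.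
suff loop d i : i + d = m -> bigstep (Loop r c) (st (F i)) x (st (F m)) x by exact: (loop m).
elim: d i => [|d IHd] i im.
  by rewrite -im addn0; apply: BLoop0; rewrite Fr -?im ?addn0 ?subnn.
apply: (@BLoopS _ _ _ _ (st (F i.+1)) x _ _ (m - i.+1)).
- by rewrite Fr; lia.
- by rewrite -GF; [apply: body|]; lia.
by apply: IHd; rewrite -im addSnnS.
Qed.

Lemma runs_loop c L j m (F : nat -> seq nat) :
  (forall i, i <= m -> nth 0 (F i) j = m - i) ->
  (forall i, i < m -> runs c (L ++ set_nth 0 (F i) j (m - i.+1)) (L ++ F i.+1)) ->
  runs (Loop (size L + j) c) (L ++ F 0) (L ++ F m).
Proof.
move=> Fj; apply: (@runs_loop_seq _ _ _ (fun i => L ++ F i)) => i im.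
  by rewrite st_cat Fj.
by rewrite upd_st.
Qed.

Lemma runs_clear L v T : runs (Loop (size L) Skip) (L ++ v :: T) (L ++ 0 :: T).
Proof.
pose F i := v - i :: T.
have -> : L ++ v :: T = L ++ F 0 by rewrite /F subn0.
have -> : L ++ 0 :: T = L ++ F v by rewrite /F subnn.
rewrite -[size L]addn0; apply: runs_loop => //= i _ x; exact: BSkip.
Qed.

(** * Compiling expressions to counter programs *)

Definition transfer (r d : nat) : cmd := Loop r (Inc d).

Lemma runs_transfer L v y : runs (transfer (size L).+1 (size L)) (L ++ [:: v; y]) (L ++ [:: v + y]).
Proof.
pose F i := [:: v + i; y - i].
apply: (@runs_cat0r 1); rewrite -catA /= -addn1.
have -> : L ++ [:: v; y] = L ++ F 0 by rewrite /F subn0 addn0.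
have -> : L ++ [:: v + y; 0] = L ++ F y by rewrite /F subnn.
apply: runs_loop => // i iy /=; rewrite -{1}[size L]addn0.
by have := @runs_inc L [:: v + i; y - i.+1] 0; rewrite /F addnS.
Qed.

(** A loop destroys its counter, so [r] is moved to the scratch register [a.+1] and then back, with
    [a] counting along. *)
Definition copy (a r : nat) : cmd := Seq (Loop r (Inc a.+1)) (Loop a.+1 (Seq (Inc r) (Inc a))).

(** The environment occupies the [d] registers from [o] on, the result goes to register [o + d], and
    all registers above are 0 before and after. Restricting the environment to its last entries
    merely shifts [o]. *)
Fixpoint compile (e : expr) (o d : nat) : cmd :=
  let a := o + d in
  match e with
  | EVar i => if i < d then copy a (o + i) else Skip
  | EZero => Skip
  | ESucc e => Seq (compile e o d) (Inc a)
  | ELet e1 e2 =>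
      Seq (compile e1 o d) (Seq (compile e2 o d.+1) (Seq (Loop a Skip) (transfer a.+1 a)))
  | ELast m e => compile e (o + (d - m)) (d - (d - m))
  | ERec n z b =>
      Seq (compile n o d) (Seq (compile z o d.+2)
        (Seq (Loop a (Seq (compile b o d.+3)
                       (Seq (Loop a.+2 Skip) (Seq (transfer a.+3 a.+2) (Inc a.+1)))))
             (Seq (Loop a.+1 Skip) (Seq (transfer a.+2 a.+1) (transfer a.+1 a)))))
  end.

Lemma runs_copy P v Q : let L := P ++ v :: Q in
  runs (copy (size L) (size P)) L (L ++ [:: v]).
Proof.
move=> L; pose Pi i := P ++ i :: Q.
have szP i : size (Pi i) = size L by rewrite !size_cat.
apply: (@runs_seq _ _ _ (Pi 0 ++ [:: 0; v])).
  pose F i := v - i :: Q ++ [:: 0; i].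
  apply: (@runs_cat0l 2).
  have -> : L ++ nseq 2 0 = P ++ F 0 by rewrite /F subn0 -catA.
  have -> : Pi 0 ++ [:: 0; v] = P ++ F v by rewrite /F subnn -catA.
  rewrite -[size P]addn0; apply: runs_loop => //= i iv.
  have := @runs_inc (Pi (v - i.+1)) [:: 0; i] 1.
  by rewrite szP addn1 -!catA.
pose F i := Pi i ++ [:: i; v - i]; pose G i := Pi i ++ [:: i; v - i.+1].
apply: (@runs_cat0r 1).
have -> : Pi 0 ++ [:: 0; v] = F 0 by rewrite /F subn0.
have -> : (L ++ [:: v]) ++ nseq 1 0 = F v by rewrite /F subnn -catA.
apply: (@runs_loop_seq _ _ _ F G) => i iv.
- by rewrite -(szP i) -addn1 st_cat.
- by rewrite -(szP i) -[(size _).+1]addn1 upd_st.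
apply: (@runs_seq _ _ _ (Pi i.+1 ++ [:: i; v - i.+1])).
  have := @runs_inc P (i :: Q ++ [:: i; v - i.+1]) 0.
  by rewrite addn0 /G /Pi -!catA.
have := @runs_inc (Pi i.+1) [:: i; v - i.+1] 0.
by rewrite szP addn0.
Qed.

Lemma runs_compile e pre env :
  runs (compile e (size pre) (size env)) (pre ++ env) (pre ++ env ++ [:: ev env e]).
Proof.
elim: e pre env => [i||e IHe|e1 IH1 e2 IH2|m e IHe|n IHn z IHz b IHb] pre env /=.
- case: ltnP => [ie|ei].
    rewrite catA -size_cat -{1 2}(cat_take_drop i env) (drop_nth 0) //.
    have := @runs_copy (pre ++ take i env) (nth 0 env i) (drop i.+1 env).
    by rewrite !size_cat size_takel 1?ltnW // -!catA -drop_nth // cat_take_drop /=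
      size_cat -catA size_drop subnKC ?(ltnW ie).
  by rewrite nth_default // catA; apply: (@runs_cat0l 1) => x; apply: BSkip.
- by rewrite catA; apply: (@runs_cat0l 1) => x; apply: BSkip.
- apply: runs_seq (IHe _ _) _.
  by have := @runs_inc (pre ++ env) [:: ev env e] 0; rewrite size_cat addn0 -!catA.
- set v := ev env e1; apply: runs_seq (IH1 _ _) _.
  have {}IH2 := IH2 pre (env ++ [:: v]); rewrite size_cat addn1 -!catA in IH2.
  apply: runs_seq IH2 _; set w := ev _ e2; rewrite -size_cat.
  apply: (@runs_seq _ _ _ ((pre ++ env) ++ [:: 0; w])).
    by have := @runs_clear (pre ++ env) v [:: w]; rewrite -!catA.
  by have := @runs_transfer (pre ++ env) 0 w; rewrite -!catA add0n.
- have := IHe (pre ++ take (size env - m) env) (drop (size env - m) env).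
  by rewrite -!catA cat_take_drop (catA (take _ _)) cat_take_drop
    size_cat size_takel ?leq_subr // size_drop.
- set N := ev env n; apply: runs_seq (IHn _ _) _; set z0 := ev _ z.
  have {}IHz := IHz pre (env ++ [:: N; 0]); rewrite size_cat addn2 -!catA -/z0 in IHz.
  apply: (@runs_seq _ _ _ (pre ++ env ++ [:: N; 0; z0])).
    (* The index register starts as a trailing zero, without any code. *)
    apply: (@runs_cat0l 1); rewrite -!catA; exact: IHz.
  pose f i acc := ev (env ++ [:: N - i.+1; i; acc]) b.
  pose F i := [:: N - i; i; iteri i f z0].
  set L := pre ++ env; have szL : size pre + size env = size L by rewrite size_cat.
  rewrite szL !(catA pre).
  apply: (@runs_seq _ _ _ (L ++ F N)).
    have -> : L ++ [:: N; 0; z0] = L ++ F 0 by rewrite /F subn0.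
    rewrite -[size L]addn0; apply: runs_loop => // i iN /=; rewrite addn0.
    have {}IHb := IHb pre (env ++ [:: N - i.+1; i; iteri i f z0]).
    rewrite size_cat /= addn3 -!catA in IHb; rewrite /L -!catA /=.
    apply: runs_seq IHb _; rewrite -/(f i _); set y := f i _; rewrite (catA pre) -/L.
    pose L2 := L ++ [:: N - i.+1; i].
    have szL2 : size L2 = (size L).+2 by rewrite size_cat addn2.
    apply: (@runs_seq _ _ _ (L2 ++ [:: 0; y])).
      by have := @runs_clear L2 (iteri i f z0) [:: y]; rewrite szL2 -!catA.
    apply: (@runs_seq _ _ _ (L2 ++ [:: y])).
      by have := @runs_transfer L2 0 y; rewrite szL2.
    have := @runs_inc L [:: N - i.+1; i; y] 1.
    by rewrite addn1 /= /L2 /L -!catA.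
  rewrite /F subnn; set y := iteri N f z0.
  have sz1 : size (L ++ [:: 0]) = (size L).+1 by rewrite size_cat addn1.
  apply: (@runs_seq _ _ _ (L ++ [:: 0; 0; y])).
    by have := @runs_clear (L ++ [:: 0]) N [:: y]; rewrite sz1 -!catA.
  apply: (@runs_seq _ _ _ (L ++ [:: 0; y])).
    by have := @runs_transfer (L ++ [:: 0]) 0 y; rewrite sz1 -!catA.
  by have := @runs_transfer L 0 y.
Qed.

Definition read_bit (b : bool) : cmd :=
  let dbl := call2 add_e (EVar 1) (EVar 1) in
  Seq (compile (if b then ESucc dbl else dbl) 0 2)
      (Seq (Loop 1 Skip) (Seq (transfer 2 1) (Inc 0))).

Lemma runs_read_bit b n X : runs (read_bit b) [:: n; X] [:: n.+1; X + X + b].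
Proof.
apply: runs_seq (@runs_compile _ [::] [:: n; X]) _ => /=.
have -> : ev [:: n; X] (let dbl := call2 add_e (EVar 1) (EVar 1) in
            if b then ESucc dbl else dbl) = X + X + b.
  by case: b; rewrite /= ev_add ?addn1 ?addn0.
apply: runs_seq (@runs_clear [:: n] X [:: X + X + b]) _.
apply: runs_seq (@runs_transfer [:: n] 0 (X + X + b)) _.
exact: (@runs_inc [::] [:: n; X + X + b] 0).
Qed.

Definition evaluate (e : expr) : cmd := Seq (Read (read_bit false) (read_bit true)) (compile e 0 2).

Lemma bigstep_evaluate e x :
  bigstep (evaluate e) (st [::]) x
          (st [:: size x; bval x; ev [:: size x; bval x] e]) [::].
Proof.
apply: (BSeq _ (@runs_compile e [::] [:: size x; bval x] [::])).
rewrite -(st_cat0 [::] 2).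
suff loop y : bigstep (Read (read_bit false) (read_bit true)) (st [:: size y; bval y]) x
    (st [:: size (y ++ x); bval (y ++ x)]) [::] by exact: (loop [::]).
elim: x y => [|b x IHx] y; first by rewrite cats0; apply: BRead0.
apply: (@BReadS _ _ _ _ _ (st [:: size (rcons y b); bval (rcons y b)]) x).
  by rewrite size_rcons bval_rcons; case: b; apply: runs_read_bit.
by rewrite -cat_rcons.
Qed.

(** * Machine code on one tape *)

(* Code for a machine with one work tape, whose cells are blank or not, and a position
   sensor for cell 0. *)
Inductive instr :=
| IRight
| ILeft
| IWrite of bool
| IJmp of nat
| IBlank of nat
| IAway of nat
| IRead of nat & nat
| IHalt of bool.

Record mconf := MConf { m_pc : nat; m_pos : nat; m_tape : nat -> bool; m_in : seq bool }.

Definition mnext (i : instr) (c : mconf) : mconf :=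
  let: MConf q p w x := c in
  match i with
  | IRight => MConf q.+1 p.+1 w x
  | ILeft => MConf q.+1 p.-1 w x
  | IWrite b => MConf q.+1 p (fun j => if j == p then b else w j) x
  | IJmp q' => MConf q' p w x
  | IBlank q' => MConf (if w p then q.+1 else q') p w x
  | IAway q' => MConf (if p == 0 then q.+1 else q') p w x
  | IRead q0 q1 =>
      if x is b :: x' then MConf (if b then q1 else q0) p w x' else MConf q.+1 p w x
  | IHalt _ => c
  end.

Definition is_halt (i : instr) : bool := if i is IHalt _ then true else false.

Inductive mrun (P : seq instr) : mconf -> mconf -> Prop :=
| MRefl c : mrun P c c
| MStep i c c' : onth P (m_pc c) = Some i -> ~~ is_halt i ->
    mrun P (mnext i c) c' -> mrun P c c'.

Lemma mrun_step P q p w x i c' : onth P q = Some i -> ~~ is_halt i ->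
  mrun P (mnext i (MConf q p w x)) c' -> mrun P (MConf q p w x) c'.
Proof. exact: (@MStep P i (MConf q p w x)). Qed.

Lemma mrun_trans P c1 c2 c3 : mrun P c1 c2 -> mrun P c2 c3 -> mrun P c1 c3.
Proof. by move=> h; elim: h c3 => // i c c' Pi hi _ IH c3 /IH; apply: MStep. Qed.

Definition code_at (P : seq instr) (q : nat) (l : seq instr) : Prop :=
  exists pre post, P = pre ++ l ++ post /\ size pre = q.

Lemma code_at_cat P q l1 l2 :
  code_at P q (l1 ++ l2) -> code_at P q l1 /\ code_at P (q + size l1) l2.
Proof.
move=> [pre [post [-> <-]]]; split.
  by exists pre, (l2 ++ post); rewrite -!catA.
by exists (pre ++ l1), post; rewrite size_cat -!catA.
Qed.

Lemma code_at_cons P q i l :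
  code_at P q (i :: l) -> onth P q = Some i /\ code_at P q.+1 l.
Proof.
rewrite -cat1s => /code_at_cat[[pre [post [-> <-]]] h]; split; last by rewrite -addn1.
by elim: pre {h}.
Qed.

Lemma mrun_right P q p w x m : code_at P q (nseq m IRight) ->
  mrun P (MConf q p w x) (MConf (q + m) (p + m) w x).
Proof.
elim: m q p => [|m IHm] q p /=; first by rewrite !addn0 => _; apply: MRefl.
by case/code_at_cons=> Pq /IHm h; apply: (mrun_step Pq) => //=; rewrite -!addSnnS.
Qed.

Lemma mrun_left P q p w x m : code_at P q (nseq m ILeft) ->
  mrun P (MConf q (p + m) w x) (MConf (q + m) p w x).
Proof.
elim: m q => [|m IHm] q /=; first by rewrite !addn0 => _; apply: MRefl.
by case/code_at_cons=> Pq /IHm h; apply: (mrun_step Pq) => //=; rewrite -addSnnS addnS.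
Qed.

(** A left step at cell 0 stays there, so stepping before testing is harmless. *)
Definition home_code (q : nat) : seq instr := [:: ILeft; IAway q].

Lemma mrun_home P q p w x : code_at P q (home_code q) ->
  mrun P (MConf q p w x) (MConf q.+2 0 w x).
Proof.
case/code_at_cons=> Pq /code_at_cons[Pq1 _].
elim: p => [|[|p] IHp]; apply: (mrun_step Pq) => //=; apply: (mrun_step Pq1) => //=.
- exact: MRefl.
- exact: MRefl.
Qed.

(** * Counters as tracks of one tape *)

Section Registers.

Variable R : nat.

(* Register r is held in unary on the cells congruent to r modulo R. *)
Definition track (s : regs) (p : nat) : bool := p %/ R < s (p %% R).

Lemma track_cell s r j : r < R -> track s (j * R + r) = (j < s r).
Proof.
by move=> rR; rewrite /track divnMDl ?modnMDl ?divn_small ?modn_small ?addn0 //; lia.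
Qed.

Lemma cell_eq p j r : r < R -> (p == j * R + r) = (p %/ R == j) && (p %% R == r).
Proof.
move=> rR; have R0 : 0 < R by lia.
apply/eqP/andP => [->|[/eqP<- /eqP<-]]; last exact: divn_eq.
by rewrite divnMDl // modnMDl divn_small // modn_small // addn0.
Qed.

Lemma track_inc s r : r < R ->
  (fun p => if p == s r * R + r then true else track s p) = track (upd s r (s r).+1).
Proof.
move=> rR; apply: functional_extensionality => p; rewrite cell_eq // /track /upd.
by have [->|_] := eqVneq (p %% R) r; rewrite ?andbF // andbT ltnS; case: ltngtP.
Qed.

Lemma track_dec s r m : r < R -> s r = m.+1 ->
  (fun p => if p == m * R + r then false else track s p) = track (upd s r m).
Proof.
move=> rR sr; apply: functional_extensionality => p; rewrite cell_eq // /track /upd.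
by have [->|_] := eqVneq (p %% R) r; rewrite ?andbF // andbT sr ltnS; case: ltngtP.
Qed.

(** Strides of [R] cells keep the head on its track until the first blank, the end of the unary
    number. *)
Definition seek_code (q : nat) : seq instr :=
  IBlank (q + R + 2) :: nseq R IRight ++ [:: IJmp q].

Lemma size_seek q : size (seek_code q) = R + 2.
Proof. by rewrite /= size_cat size_nseq /= addn1 addn2. Qed.

Lemma mrun_seek P q r j s x : code_at P q (seek_code q) -> r < R -> j <= s r ->
  mrun P (MConf q (j * R + r) (track s) x) (MConf (q + R + 2) (s r * R + r) (track s) x).
Proof.
case/code_at_cons=> Pq /code_at_cat[right]; rewrite size_nseq => /code_at_cons[Pj _] rR.
elim: {j}(s r - j) {-2}j (erefl (s r - j)) => [|d IHd] j dE js.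
  have -> : j = s r by lia.
  by apply: (mrun_step Pq) => //=; rewrite track_cell // ltnn; apply: MRefl.
apply: (mrun_step Pq) => //=; rewrite track_cell // (_ : j < s r); last by lia.
apply: mrun_trans (mrun_right _ _ _ right) _; apply: (mrun_step Pj) => //=.
by rewrite addnAC -mulSnr; apply: IHd; lia.
Qed.

(** Jump addresses are absolute, hence the argument [q]. Each block starts and ends with the head at
    cell 0, so that blocks compose. A decrement seeks the first blank of the track, goes back [R]
    cells and erases the last mark. *)
Fixpoint gen (c : cmd) (q : nat) : seq instr :=
  match c with
  | Skip => [::]
  | Inc r => nseq r IRight ++ seek_code (q + r) ++ IWrite true :: home_code (q + r + R + 3)
  | Seq c d => let l := gen c q in l ++ gen d (q + size l)
  | Loop r c =>
      let b := q + r + R + R + 6 in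
      let l := gen c b in
      let z := b + size l + 1 in
      nseq r IRight ++ IBlank z :: seek_code (q + r + 1) ++ nseq R ILeft ++
      IWrite false :: home_code (q + r + R + R + 4) ++ l ++ IJmp q :: home_code z
  | Read c d =>
      let lc := gen c (q + 2) in
      let q1 := q + 2 + size lc + 1 in
      let ld := gen d q1 in
      IRead (q + 2) q1 :: IJmp (q1 + size ld + 1) :: lc ++ IJmp q :: ld ++ [:: IJmp q]
  end.

Fixpoint fits (c : cmd) : bool :=
  match c with
  | Skip => true
  | Inc r => r < R
  | Seq c d => fits c && fits d
  | Loop r c => (r < R) && fits c
  | Read c d => fits c && fits d
  end.

Lemma gen_loopP P r c q :
  let b := q + r + R + R + 6 in let z := b + size (gen c b) + 1 in
  code_at P q (gen (Loop r c) q) ->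
  code_at P q (nseq r IRight) /\ onth P (q + r) = Some (IBlank z) /\
  code_at P (q + r + 1) (seek_code (q + r + 1)) /\
  code_at P (q + r + R + 3) (nseq R ILeft) /\
  onth P (q + r + R + R + 3) = Some (IWrite false) /\
  code_at P (q + r + R + R + 4) (home_code (q + r + R + R + 4)) /\
  code_at P b (gen c b) /\ onth P (b + size (gen c b)) = Some (IJmp q) /\
  code_at P z (home_code z) /\ q + size (gen (Loop r c) q) = z.+2.
Proof.
move=> b z; case/(@code_at_cat _ _ (nseq r IRight))=> cr; rewrite size_nseq.
case/code_at_cons=> cb; rewrite -addn1.
case/(@code_at_cat _ _ (seek_code _))=> cs; rewrite size_seek.
case/(@code_at_cat _ _ (nseq R ILeft))=> cL; rewrite size_nseq => /code_at_cons[cw].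
case/(@code_at_cat _ _ (home_code _))=> ch /(@code_at_cat _ _ (gen c b))[cc] /code_at_cons[cj cz].
have e1 : q + r + 1 + (R + 2) = q + r + R + 3 by lia.
have e2 : q + r + R + 3 + R = q + r + R + R + 3 by lia.
have e3 : (q + r + R + R + 3).+1 = q + r + R + R + 4 by lia.
have e4 : q + r + R + R + 4 + 2 = b by rewrite /b; lia.
rewrite e1 in cL cw ch cc cj cz; rewrite e2 in cw ch cc cj cz.
rewrite e3 in ch cc cj cz; rewrite [size _]/= e4 in cc cj cz.
rewrite -addn1 -/z in cz.
do 9! split => //.
rewrite /= !(size_cat, size_nseq) /= !(size_cat, size_nseq) /= -/b size_cat /=.
by rewrite /z; move: (size _) => g; rewrite /b; lia.
Qed.

Lemma mrun_gen P c s x s' x' q : bigstep c s x s' x' -> fits c ->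
  code_at P q (gen c q) ->
  mrun P (MConf q 0 (track s) x) (MConf (q + size (gen c q)) 0 (track s') x').
Proof.
move=> h; elim: h q => {c s x s' x'}.
- by move=> s x q _ _; rewrite addn0; apply: MRefl.
- move=> r s x q rR /(@code_at_cat _ _ (nseq r IRight))[cr]; rewrite size_nseq.
  case/(@code_at_cat _ _ (seek_code _))=> cs; rewrite size_seek => /code_at_cons[cw ch].
  apply: mrun_trans (mrun_right _ _ _ cr) _.
  apply: mrun_trans (@mrun_seek _ _ r 0 _ _ cs rR _) _ => //.
  rewrite addnA in cw ch; apply: (mrun_step cw) => //=; rewrite track_inc //.
  have e : (q + r + R + 2).+1 = q + r + R + 3 by lia.
  rewrite e in ch *; have -> : q + size (gen (Inc r) q) = (q + r + R + 3).+2.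
    by rewrite /= size_cat size_nseq /= !size_cat size_nseq /=; lia.
  exact: mrun_home.
- move=> c d s1 x1 s2 x2 s3 x3 _ IHc _ IHd q /andP[fc fd].
  case/(@code_at_cat _ _ (gen c q))=> /(IHc _ fc) rc /(IHd _ fd) rd.
  apply: mrun_trans rc _; rewrite /= size_cat addnA; exact: rd.
- move=> r c s x sr q /andP[rR fc] /gen_loopP[cr [cb [_ [_ [_ [_ [_ [_ [ch ->]]]]]]]]].
  apply: mrun_trans (mrun_right _ _ _ cr) _; apply: (mrun_step cb) => //=.
  have := @track_cell s r 0 rR; rewrite sr => ->.
  exact: mrun_home.
- move=> r c s1 x1 s2 x2 s3 x3 m sr _ IHc _ IHl q fl cl; have /andP[rR fc] := fl.
  apply: mrun_trans (IHl q fl cl).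
  case/gen_loopP: cl => [cr [cb [cs [cL [cw [ch [cc [cj _]]]]]]]].
  apply: mrun_trans (mrun_right _ _ _ cr) _; apply: (mrun_step cb) => //=.
  have := @track_cell s1 r 0 rR; rewrite mul0n !add0n [in X in _ = X]sr => ->.
  rewrite /= -[(q + r).+1]addn1.
  apply: mrun_trans (@mrun_seek _ _ r 0 _ _ cs rR _) _ => //.
  rewrite (_ : q + r + 1 + R + 2 = q + r + R + 3); last by lia.
  rewrite sr (_ : m.+1 * R + r = m * R + r + R); last by lia.
  apply: mrun_trans (mrun_left _ _ _ cL) _.
  rewrite (_ : q + r + R + 3 + R = q + r + R + R + 3); last by lia.
  apply: (mrun_step cw) => //=; rewrite (track_dec rR sr) -addnS.
  apply: mrun_trans (mrun_home _ _ _ ch) _; rewrite -2!addnS.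
  apply: mrun_trans (IHc _ fc cc) _; apply: (mrun_step cj) => //; exact: MRefl.
- move=> c d s q _ /code_at_cons[cR /code_at_cons[cJ _]].
  apply: (mrun_step cR) => //=; apply: (mrun_step cJ) => //=.
  rewrite size_cat /= size_cat /=; set l := size _; set l' := size _.
  rewrite (_ : q + 2 + l + 1 + l' + 1 = q + (l + (l' + 1).+1).+2); last by lia.
  exact: MRefl.
- move=> c d s1 b x1 s2 x2 s3 x3 _ IHb _ IHl q fl cl; have /andP[fc fd] := fl.
  apply: mrun_trans (IHl q fl cl).
  case/code_at_cons: cl => cR /code_at_cons[_]; rewrite -addn2.
  case/(@code_at_cat _ _ (gen c (q + 2)))=> cc /code_at_cons[cJ]; rewrite -addn1.
  case/code_at_cat=> cd /code_at_cons[cJ' _].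
  apply: (mrun_step cR) => //=; case: b IHb => IHb.
    by apply: mrun_trans (IHb _ fd cd) _; apply: (mrun_step cJ') => //; apply: MRefl.
  by apply: mrun_trans (IHb _ fc cc) _; apply: (mrun_step cJ) => //; apply: MRefl.
Qed.

End Registers.

(** * Turing machines *)

Section Machine.

Variables (k : nat) (P : seq instr) (x0 : seq bool).

Let tu : 'I_(2 + k.+1) := lshift k.+1 ord0.
Let tx : 'I_(2 + k.+1) := lshift k.+1 ord_max.
Let tw : 'I_(2 + k.+1) := rshift 2 ord0.

(* Avoids the final states 1 and 2. *)
Definition pc_state (q : nat) : nat := if q is 0 then 0 else q.+2.

Definition next_state (i : instr) (q : nat) (home : bool) (xs : sym) (w : bool) : nat :=
  match i with
  | IHalt b => if b then st_acc else st_rej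
  | IRead q0 q1 => pc_state (if xs is Some b then (if b then q1 else q0) else q.+1)
  | IJmp q' => pc_state q'
  | IBlank q' => pc_state (if w then q.+1 else q')
  | IAway q' => pc_state (if home then q.+1 else q')
  | _ => pc_state q.+1
  end.

Definition cell_sym (b : bool) : sym := if b then Some true else None.

Definition work_write (i : instr) (w : bool) : sym :=
  cell_sym (if i is IWrite b then b else w).

(* The head of the u tape moves along with the work head, and u = [:: true]
   makes it sense cell 0. *)
Definition work_move (i : instr) (home : bool) : dir :=
  match i with
  | IRight => DR
  | ILeft => if home then DS else DL
  | _ => DS
  end.

Definition input_move (i : instr) (xs : sym) : dir :=
  match i, xs with IRead _ _, Some _ => DR | _, _ => DS end.

Definition instr_rule (qr : nat * (2 + k.+1).-tuple sym) : rule k.+1 :=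
  let: (q, rd) := qr in
  let i := nth (IHalt false) P q in
  let home := tnth rd tu != None in let w := tnth rd tw != None in
  Rule (pc_state q) rd (next_state i q home (tnth rd tx) w)
    [tuple work_write i w | _ < k.+1]
    [tuple if j == tx then input_move i (tnth rd tx) else work_move i home | j < 2 + k.+1].

(** There is a rule for every address and every tuple of symbols read. All work tapes are written
    alike and all heads except that of x move together, so [represents] need only follow the first
    work tape. *)
Definition machine : TM k.+1 :=
  MkTM [seq instr_rule qr |
        qr <- allpairs pair (iota 0 (size P)) (enum {: (2 + k.+1).-tuple sym})].

Lemma pc_state_inj : injective pc_state.
Proof. by move=> [|p] [|q] // []->. Qed.

Lemma pc_state_nfinal q : (pc_state q == st_acc) || (pc_state q == st_rej) = false.
Proof. by case: q. Qed.

Definition represents (c : config k.+1) (m : mconf) : Prop :=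
  [/\ c_state c = pc_state (m_pc m),
      c_head c tu = Posz (m_pos m), c_head c tw = Posz (m_pos m),
      (exists2 j, c_head c tx = Posz j & m_in m = drop j x0) &
      forall p, c_work c ord0 (Posz p) = cell_sym (m_tape m p)].

(** By injectivity of [pc_state], every matching rule comes from the pair [(q, rd)], so the first
    match is the intended one. *)
Lemma step_machine (c : config k.+1) q i : onth P q = Some i -> c_state c = pc_state q ->
  let rd := cur_reads [:: true] x0 c in let r := instr_rule (q, rd) in
  step machine [:: true] x0 c =
    Some (Config (r_next r)
            (fun j => (c_head c j + dir_delta (tnth (r_moves r) j))%R)
            (fun w p => if p == c_head c (rshift 2 w)
                        then tnth (r_writes r) w else c_work c w p)).
Proof.
move=> Pq cq rd r; rewrite /step cq pc_state_nfinal.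
set good := fun r : rule k.+1 => _.
have -> : [seq r <- tm_rules machine | good r] =
   map instr_rule [seq qr <- allpairs pair (iota 0 (size P)) (enum {: (2 + k.+1).-tuple sym})
     | (qr.1 == q) && (qr.2 == rd)].
  rewrite filter_map; congr map; apply: eq_filter => -[q' rd']; rewrite /good /=.
  by rewrite (inj_eq pc_state_inj).
have : (q, rd) \in [seq qr <- allpairs pair (iota 0 (size P)) (enum {: (2 + k.+1).-tuple sym})
     | (qr.1 == q) && (qr.2 == rd)].
  rewrite mem_filter /= !eqxx /=; apply: allpairs_f; last by rewrite mem_enum.
  by rewrite mem_iota /= add0n ltnNge; apply/negP => /onth_default E; rewrite E in Pq.
case E: [seq _ <- _ | _] => [//|[q' rd'] s] _.
have := mem_head (q', rd') s; rewrite -[in X in X -> _]E.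
by rewrite mem_filter /= => /andP[/andP[/eqP-> /eqP->]].
Qed.

Section Sensors.

Variables (c : config k.+1) (m : mconf).
Hypothesis cm : represents c m.
Let rd := cur_reads [:: true] x0 c.

Lemma sense_home : (tnth rd tu != None) = (m_pos m == 0).
Proof.
case: cm => _ hu _ _ _.
rewrite tnth_mktuple /read_sym (unsplitK (inl ord0)) /= hu /=.
by case: (m_pos m) => [|p].
Qed.

Lemma sense_input : tnth rd tx = ohead (m_in m).
Proof.
case: cm => _ _ _ [j hx ->] _.
rewrite tnth_mktuple /read_sym (unsplitK (inl ord_max)) /= hx /=.
by case: ltnP => jx; [rewrite (drop_nth false)|rewrite drop_oversize].
Qed.

Lemma sense_work : (tnth rd tw != None) = m_tape m (m_pos m).
Proof.
case: cm => _ _ hw _ wk.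
rewrite tnth_mktuple /read_sym (unsplitK (inr ord0)) /= hw wk.
by case: m_tape.
Qed.

End Sensors.

Lemma machine_step c m i : represents c m -> onth P (m_pc m) = Some i -> ~~ is_halt i ->
  exists2 c', step machine [:: true] x0 c = Some c' & represents c' (mnext i m).
Proof.
move=> cm Pi hi; have [cq hu hw [j hx mx] wk] := cm.
have ne : (tu == tx) = false by [].
have nw : (tw == tx) = false by apply/negbTE; rewrite -val_eqE.
rewrite (step_machine Pi cq) /instr_rule; cbv beta iota zeta.
have iP : nth (IHalt false) P (m_pc m) = i by exact: onth_nth Pi.
rewrite iP (sense_home cm) (sense_input cm) (sense_work cm); eexists; first by reflexivity.
case: m cm mx hu hw wk {Pi cq iP} => q p w x cm mx hu hw wk.
split; rewrite /= ?tnth_mktuple ?ne ?nw ?eqxx ?hu ?hw.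
- by case: (i) hi => //= q0 q1 _; case: (x).
- by case: (i) hi => [||b|q'|q'|q'|q0 q1|b] //= _; case: (p) => [|p'] //=; case: (x) => //= *; lia.
- by case: (i) hi => [||b|q'|q'|q'|q0 q1|b] //= _; case: (p) => [|p'] //=; case: (x) => //= *; lia.
- rewrite /= in mx; exists (if (i, ohead x) is (IRead _ _, Some _) then j.+1 else j).
    by rewrite hx; case: (i) hi => //= *; case: (x) => /= *; lia.
  case: i hi => //= q0 q1 _; case: x mx {cm hu hw wk} => //= b x E.
  by rewrite -addn1 addnC -drop_drop -E drop1.
- move=> p'; rewrite /= in wk *; rewrite wk (_ : (Posz p' == Posz p) = (p' == p)) //.
  by case: (i) hi => [||b|q'|q'|q'|q0 q1|b] //= _; case: eqP => [e|_]; rewrite ?e //; case: (x).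
Qed.

Lemma machine_run m m' c t : mrun P m m' -> represents c m ->
  exec machine [:: true] x0 t = Some c ->
  exists t' c', exec machine [:: true] x0 t' = Some c' /\ represents c' m'.
Proof.
move=> h; elim: h c t => {m m'} [m|i m m' Pi hi _ IH] c t cm ct; first by exists t, c.
have [c' cc' cm'] := machine_step cm Pi hi.
by apply: (IH c' t.+1 cm'); rewrite /= ct.
Qed.

Lemma machine_out m b : mrun P (MConf 0 0 (fun=> false) x0) m ->
  onth P (m_pc m) = Some (IHalt b) -> TM_out machine [:: true] x0 b.
Proof.
move=> h Pm; have [] := machine_run (t := 0) (c := init_config k.+1) h _ erefl.
  by split=> //; exists 0; rewrite ?drop0.
move=> t [c [ct cm]]; have [cq _ _ _ _] := cm.
(* The halting instruction takes one more step to enter the final state. *)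
exists t.+1; eexists; split; first by rewrite /= ct (step_machine Pm cq).
by rewrite /= -odflt_onth Pm; case: (b).
Qed.

End Machine.

Lemma fits_max R R' c : R <= R' -> fits R c -> fits R' c.
Proof.
move=> RR; elim: c => //= [r|c IHc d IHd|r c IHc|c IHc d IHd].
- by move=> rR; apply: leq_trans RR.
- by case/andP=> /IHc-> /IHd->.
- by case/andP=> rR /IHc->; rewrite andbT; apply: leq_trans RR.
- by case/andP=> /IHc-> /IHd->.
Qed.

Lemma fits_exists c : exists R, fits R c.
Proof.
elim: c => [|r|c [R1 f1] d [R2 f2]|r c [R f]|c [R1 f1] d [R2 f2]] /=.
- by exists 0.
- by exists r.+1.
- by exists (maxn R1 R2); rewrite (fits_max (leq_maxl _ _) f1) (fits_max (leq_maxr _ _) f2).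
- by exists (maxn r.+1 R); rewrite leq_maxl (fits_max (leq_maxr _ _) f).
- by exists (maxn R1 R2); rewrite (fits_max (leq_maxl _ _) f1) (fits_max (leq_maxr _ _) f2).
Qed.

Lemma TM_computes k e : 0 < k ->
  exists T : TM k, forall x, TM_out T [:: true] x (0 < ev [:: size x; bval x] e).
Proof.
(* The added [Inc 2] forces [2 < R], so that the result register 2 has a track. *)
case: k => // k _; have [R fR] := fits_exists (Seq (evaluate e) (Inc 2)).
case/andP: fR => fR R2; rewrite /= in R2.
have := fun P x => @mrun_gen R P _ _ _ _ _ 0 (bigstep_evaluate e x) fR.
move: (gen R (evaluate e) 0) => l run; set z := size l in run.
(* Cell 2 is the first cell of track 2, marked exactly when the result is positive. *)
pose tail := [:: IRight; IRight; IBlank (z + 4); IHalt true; IHalt false].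
have at0 : code_at (l ++ tail) 0 l by exists [::], tail.
have atz j : onth (l ++ tail) (z + j) = onth tail j.
  by rewrite onth_cat ltnNge leq_addr /= addKn.
exists (machine k (l ++ tail)) => x; have {}run := run _ x at0; set v := ev _ e in run *.
rewrite add0n in run.
have tr0 : track R (st [::]) = fun=> false.
  by apply: functional_extensionality => p; rewrite /track /st nth_nil ltn0.
rewrite tr0 in run.
apply: (@machine_out _ _ _ (MConf (if 0 < v then z + 3 else z + 4) 2
                              (track R (st [:: size x; bval x; v])) [::])); last first.
  by case: (0 < v); rewrite /= atz.
apply: mrun_trans run _.
have at_z := atz 0; rewrite addn0 in at_z.
have at_z1 := atz 1; rewrite addn1 in at_z1; have at_z2 := atz 2; rewrite addn2 in at_z2.
apply: (mrun_step at_z) => //; apply: (mrun_step at_z1) => //; apply: (mrun_step at_z2) => //=.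
have := @track_cell R (st [:: size x; bval x; v]) 2 0 R2; rewrite mul0n add0n => ->.
by rewrite /= addn3; exact: MRefl.
Qed.

(** * The ratio of the two complexities *)

Theorem mainTheorem10 (k : nat) (E : TM k -> seq bool) :
  0 < k ->
  (forall T T' : TM k, prefix (E T) (E T') -> T = T') ->
  exists c : rat, (0 < c)%R /\
  exists N : nat, forall n : nat, N <= n ->
    exists (f : Hfun n) (a b : nat),
      size_C f = Some a /\ size_U E f = Some b /\
      (c * (2 ^ n)%:R * b%:R <= a%:R)%R.
Proof.
move=> k0 _; have [e he] := hard_expr; have [T hT] := TM_computes e k0.
pose p := E T ++ [:: true]; have p0 : 0 < size p by rewrite size_cat addn1.
(* The factor 3 comes from [enc_len_hard], and [size p] bounds [size_U] for all n. *)
exists ((3 * size p)%:R^-1)%R; split; first by rewrite invr_gt0 ltr0n muln_gt0.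
exists 10 => n n10; have n0 : 0 < n by apply: leq_trans n10.
pose f := @hard_fun n.
have [C [wfC Cf]] := circuit_exists f n0.
have [a aE [[C' [wfC' [Cf' sC']]] _]] : exists2 a, size_C f = Some a & _ :=
  @nat_min_some _ (enc_len (size C) n)
    (ex_intro _ C (conj wfC (conj Cf erefl))).
have Uf : exists h : seq bool, size h = size p /\ forall x : n.-tuple bool, U_out E h x (f x).
  exists p; split=> // x; exists T, [:: true]; split=> //.
  by have := hT x; rewrite he size_tuple // lt0b.
have [b bE [_ bp]] : exists2 b, size_U E f = Some b & _ := nat_min_some Uf.
exists f, a, b; split=> //; split=> //.
have := enc_len_hard n10 (hard_fun_size n10 wfC' Cf'); rewrite sC' => an.
rewrite -mulrA mulrC ler_pdivrMr ?ltr0n ?muln_gt0 // -!natrM ler_nat mulnA.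
exact: leq_mul.
Qed.
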